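(* The meld of any number of balanced rectairs is a losing position of the game CRIM. That is, if $\mu^{(1)},\ldots,\mu^{(m)}$ are balanced rectairs, then $\mu^{(1)}\diamond\cdots\diamond\mu^{(m)}$ is a $\mathcal{P}$-position.
   Context: A partition is a finite weakly decreasing sequence $\lambda=[\lambda_1,\ldots,\lambda_r]$ of positive integers, called its parts; the empty partition $[\,]$ is allowed. Exponents denote repeated parts. Its conjugate is $\lambda'=[\lambda'_1,\ldots,\lambda'_{\lambda_1}]$, where $\lambda'_k$ is the largest $i$ with $\lambda_i\ge k$. The rank of $\lambda$ is $|r-\lambda_1|$ (number of rows versus number of columns). CRIM is the impartial two-player game whose positions are partitions. From $\lambda=[\lambda_1,\ldots,\lambda_r]$, a row move deletes the part $\lambda_i$ for some $1\le i\le r$. A column move takes the conjugate of the partition that results from making a row move on $\lambda'$ (i.e. it removes one column of the Young diagram). Play is normal play: the player to move at the terminal position $[\,]$ loses. A $\mathcal{P}$-position (losing position) is one from which the player who has just moved can force a win; an $\mathcal{N}$-position (winning position) is one from which the player about to move can force a win. The meld of $\mu=[\mu_1,\ldots,\mu_k]$ and $\lambda=[\lambda_1,\ldots,\lambda_m]$ is the partition $\mu\diamond\lambda=[\mu_1+\lambda_1,\ldots,\mu_1+\lambda_m,\mu_1,\mu_2,\ldots,\mu_k]$, with $[\,]\diamond\lambda=\lambda\diamond[\,]=\lambda$. The operation $\diamond$ is associative. A rectair is a partition that is either $[\,]$ or of the form $R^k_{r,c}=[c^{\,r-k},c-1,c-2,\ldots,c-k]$, where $r,c$ are positive integers and $0\le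 k<\min(r,c)$. A rectair $R^k_{r,c}$ is balanced if its rank $|r-c|$ is even, $r\ge2$ and $c\ge2$, and, when $r$ and $c$ are odd, $k<\min(r,c)-1$. The empty rectair $[\,]$ is balanced. *)

(* Defs.v *)
From HB Require Import structures.
From mathcomp Require Import all_boot ssrint.

Set Implicit Arguments.
Unset Strict Implicit.
Unset Printing Implicit Defensive.

Local Open Scope nat_scope.

Definition is_partition (s : seq nat) : bool := sorted geq s && all (ltn 0) s.

Record intpart := IntPart { parts :> seq nat; _ : is_partition parts }.

HB.instance Definition _ := [isSub for parts].
HB.instance Definition _ := [Countable of intpart by <:].

Lemma intpartP (la : intpart) : is_partition la.
Proof. exact: valP. Qed.

Definition empty_partition : intpart := @IntPart [::] isT.

(* With 0-based indices, the part la_i (i >= 1) is nth 0 la i.-1, and the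
   largest i with la_i >= k is the maximum of j.+1 over the indices j with
   nth 0 la j >= k. *)
Definition conj_parts (s : seq nat) : seq nat :=
  [seq \max_(j < size s | k <= nth 0 s j) j.+1 | k <- iota 1 (head 0 s)].

Lemma conj_parts_is_partition s : is_partition (conj_parts s).
Proof.
apply/andP; split.
  rewrite /conj_parts sorted_map.
  have: sorted ltn (iota 1 (head 0 s)) by exact: iota_ltn_sorted.
  apply: sub_sorted => k l /= lt_kl.
  apply/bigmax_leqP => j le_l.
  exact: (@leq_bigmax_cond _ _ (fun j : 'I_(size s) => j.+1) j
            (leq_trans (ltnW lt_kl) le_l)).
rewrite all_map; apply/allP => k; rewrite mem_iota /= => /andP[k_gt0].
rewrite add1n ltnS; case: s => [|x s] /= le_k.
  by move: (leq_trans k_gt0 le_k).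
apply: (leq_trans (isT : 0 < (@ord0 (size s)).+1)).
exact: (@leq_bigmax_cond _ _ (fun j : 'I_(size s).+1 => j.+1) ord0 le_k).
Qed.

Definition conjugate (la : intpart) : intpart :=
  IntPart (conj_parts_is_partition la).

Definition rank (la : intpart) : nat := `|size la - head 0 la|%N.

Definition row_move (la mu : intpart) : Prop :=
  exists2 i, i < size la & mu = take i la ++ drop i.+1 la :> seq nat.

Definition column_move (la mu : intpart) : Prop :=
  exists2 nu, row_move (conjugate la) nu & mu = conjugate nu.

Definition crim_move (la mu : intpart) : Prop :=
  row_move la mu \/ column_move la mu.

(* Forced wins under normal play: the player who has just moved forces a win
   from la iff every answer of the opponent leads to a position from which the
   player about to move forces a win, which in turn means that some move
   leads to a position of the former kind.  A terminal position is a
   P-position (vacuously). *)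
Inductive P_position (la : intpart) : Prop :=
  | P_intro of forall mu, crim_move la mu -> N_position mu
with N_position (la : intpart) : Prop :=
  | N_intro mu of crim_move la mu & P_position mu.

(* As head 0 [::] = 0, the conventions for melding with the empty partition
   are instances of the general formula. *)
Definition meld_parts (s t : seq nat) : seq nat :=
  [seq head 0 s + x | x <- t] ++ s.

Lemma meld_parts_is_partition (mu la : intpart) :
  is_partition (meld_parts mu la).
Proof.
have /andP[smu pmu] := intpartP mu; have /andP[sla pla] := intpartP la.
have geq_trans : transitive geq by move=> y x z /= xy yz; exact: leq_trans yz xy.
apply/andP; split; last first.
  rewrite all_cat pmu andbT all_map; apply: sub_all pla => x /= x_gt0.
  by rewrite addn_gt0 x_gt0 orbT.
rewrite (sorted_pairwise geq_trans) pairwise_cat -!(sorted_pairwise geq_trans).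
rewrite smu andbT; apply/andP; split; last first.
  by rewrite sorted_map; apply: sub_sorted sla => x y /=; rewrite leq_add2l.
apply/allrelP => _ y /mapP[x _ ->] y_mu /=; apply: leq_trans (leq_addr _ _).
case: (parts mu) smu y_mu => [|z s] //=; rewrite (path_sortedE geq_trans).
by case/andP=> /allP zs _; rewrite inE => /orP[/eqP-> //|/zs].
Qed.

Definition meld (mu la : intpart) : intpart :=
  IntPart (meld_parts_is_partition mu la).

Lemma head_meld_parts s t : head 0 (meld_parts s t) = head 0 s + head 0 t.
Proof. by case: t => //=; rewrite addn0. Qed.

Lemma meld0p : left_id empty_partition meld.
Proof. by move=> la; apply: val_inj; rewrite /= /meld_parts cats0 map_id. Qed.

Lemma meldp0 : right_id empty_partition meld.
Proof. by move=> la; apply: val_inj. Qed.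

Lemma meldA : associative meld.
Proof.
move=> a b c; apply: val_inj; rewrite /= {1 3}/meld_parts head_meld_parts.
rewrite /meld_parts map_cat -map_comp -catA; congr (_ ++ _).
by apply: eq_map => x /=; rewrite addnA.
Qed.

HB.instance Definition _ :=
  Monoid.isLaw.Build intpart empty_partition meld meldA meld0p meldp0.

Definition rectair_parts (k r c : nat) : seq nat :=
  nseq (r - k) c ++ [seq c - i | i <- iota 1 k].

(* la is the rectair R^k_{r,c}; la determines k, r and c. *)
Definition is_nonempty_rectair (k r c : nat) (la : intpart) : Prop :=
  [/\ 0 < r, 0 < c, k < minn r c & la = rectair_parts k r c :> seq nat].

Definition is_balanced_rectair (la : intpart) : Prop :=
  la = empty_partition \/
  exists k r c, [/\ is_nonempty_rectair k r c la,
    ~~ odd (rank la), 2 <= r, 2 <= c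
    & odd r -> odd c -> k < minn r c - 1].

(* Main.v *)
(** Read the boundary of a Young diagram from its top right corner to its bottom
left one, as a word in T (a step down, one row) and F (a step left, one column).
A move erases a letter, leading F's and trailing T's being immaterial; melding
is concatenation, in the reverse order; conjugation reverses the word and swaps
the letters.  The rectair R^k_{r,c} is the word T^p (FT)^k F^q with p = r - k and
q = c - k; it is balanced iff p, q > 0 have the same parity and either k has this
parity too or p, q >= 2.  Every erasure of a T in such a balanced block can be
answered inside the block so as to leave F^(2j) followed by balanced blocks, and
F^(2j) is absorbed by the block on its left, since adding 2j to q preserves
balance (or is immaterial when there is none).  Erasures of an F are handled by
conjugation. *)

Require Import Defs.
From mathcomp Require Import all_boot zify.

Set Implicit Arguments.
Unset Strict Implicit.
Unset Printing Implicit Defensive.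

(** * Boundary words *)

(* [true] is the letter T and [false] the letter F. *)
Notation word := (seq bool) (only parsing).

(* Keeps the zero parts, so that it is compatible with concatenation. *)
Fixpoint weak_rows (w : word) : seq nat :=
  if w is b :: w' then
    if b then count_mem false w' :: weak_rows w' else weak_rows w'
  else [::].

Definition rows (w : word) : seq nat := filter (ltn 0) (weak_rows w).

Definition dual (w : word) : word := rev (map negb w).

Lemma weak_rows_cat u v :
  weak_rows (u ++ v) =
  [seq x + count_mem false v | x <- weak_rows u] ++ weak_rows v.
Proof. by elim: u => [|[] u IHu] //=; rewrite IHu // count_cat. Qed.

Lemma rows_false j w : rows (nseq j false ++ w) = rows w.
Proof. by elim: j. Qed.

Lemma geq_trans : transitive geq.
Proof. by move=> y x z /= xy yz; exact: leq_trans yz xy. Qed.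

Lemma weak_rows_sorted w : sorted geq (weak_rows w).
Proof.
suff: path geq (count_mem false w) (weak_rows w) by apply: path_sorted.
elim: w => [|[] w IHw] //=; first by rewrite leqnn.
rewrite (path_sortedE geq_trans) (path_sorted IHw) andbT.
have:= order_path_min geq_trans IHw; apply: sub_all => x /= /leq_trans; apply.
exact: leq_addl.
Qed.

Lemma rows_is_partition w : is_partition (rows w).
Proof.
by rewrite /is_partition (sorted_filter geq_trans) ?weak_rows_sorted ?filter_all.
Qed.

Definition partition_of w : intpart := IntPart (rows_is_partition w).

Lemma dual_cat u v : dual (u ++ v) = dual v ++ dual u.
Proof. by rewrite /dual map_cat rev_cat. Qed.

Lemma dual_cons b w : dual (b :: w) = dual w ++ [:: ~~ b].
Proof. by rewrite -cat1s dual_cat. Qed.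

Lemma dualK : involutive dual.
Proof.
by move=> w; rewrite /dual map_rev revK -map_comp (eq_map negbK) map_id.
Qed.

Lemma size_dual w : size (dual w) = size w.
Proof. by rewrite size_rev size_map. Qed.

Lemma count_dual b w : count_mem b (dual w) = count_mem (~~ b) w.
Proof. by rewrite count_rev count_map; apply: eq_count; case: b => -[]. Qed.

Lemma size_weak_rows w : size (weak_rows w) = count_mem true w.
Proof. by elim: w => [|[] w IHw] //=; rewrite IHw. Qed.

(** The entries at least [k] form a prefix, so the last position of such an entry is also their
    number. *)
Lemma max_index_sorted k (s : seq nat) : sorted geq s ->
  \max_(j < size s | k <= nth 0 s j) j.+1 = count (leq k) s.
Proof.
move=> s_sorted; apply/eqP; rewrite eqn_leq; apply/andP; split.
  apply/bigmax_leqP => j le_kj.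
  rewrite -{2}(cat_take_drop j.+1 s) count_cat.
  suff: all (leq k) (take j.+1 s).
    by rewrite all_count => /eqP->; rewrite size_takel ?leq_addr.
  apply/(all_nthP 0) => i; rewrite size_takel // => lt_ij.
  rewrite nth_take //; apply: leq_trans le_kj _.
  apply: (sorted_leq_nth geq_trans leqnn 0 s_sorted); rewrite ?inE //.
  exact: leq_trans lt_ij _.
case cnt: (count (leq k) s) => [//|n].
have lt_ns : n < size s by rewrite -cnt count_size.
apply: (@leq_bigmax_cond _ _ (fun j : 'I_(size s) => j.+1) (Ordinal lt_ns)) => /=.
rewrite leqNgt; apply/negP => lt_nk.
have: count (leq k) s <= n; last by rewrite cnt ltnn.
rewrite -(cat_take_drop n s) count_cat.
have /eqP-> : count (leq k) (drop n s) == 0.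
  rewrite eqn0Ngt -has_count -all_predC; apply/(all_nthP 0) => i.
  rewrite size_drop nth_drop /= => lt_i; rewrite -ltnNge.
  apply: leq_ltn_trans lt_nk.
  apply: (sorted_leq_nth geq_trans leqnn 0 s_sorted); rewrite ?inE //.
    by lia.
  exact: leq_addr.
by rewrite addn0 (leq_trans (count_size _ _)) // size_take; case: ifP; lia.
Qed.

Lemma conj_rows w : conj_parts (rows w) = rows (dual w).
Proof.
(* Columns are counted in [weak_rows w] instead: zero rows do not matter for [k > 0], and the first
   weak row is zero only if all are. *)
transitivity [seq count (leq k) (weak_rows w)
             | k <- iota 1 (head 0 (weak_rows w))].
  have -> : head 0 (weak_rows w) = head 0 (rows w).
    have := weak_rows_sorted w; rewrite /rows.
    case: (weak_rows w) => [|[|x] s] //=; rewrite (path_sortedE geq_trans).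
    case/andP=> /allP s0 _; case fs: (filter _ s) => [|y t] //=.
    have: y \in filter (ltn 0) s by rewrite fs mem_head.
    by rewrite mem_filter => /andP[y_gt0 /s0 /=]; rewrite leqn0 => /eqP->.
  apply/eq_in_map => k; rewrite mem_iota => /andP[k_gt0 _].
  rewrite max_index_sorted; last by case/andP: (rows_is_partition w).
  rewrite count_filter; apply: eq_count => x /=.
  by rewrite /=; lia.
(* A final T only adds a zero row. A final F lengthens every row by one, which puts a column as tall
   as the number of T's before the others. *)
elim/last_ind: w => [//|w [] IHw]; rewrite -cats1 dual_cat weak_rows_cat /=.
  rewrite (eq_map addn0) map_id -[rows _]/(rows (dual w)) -IHw.
  have -> : head 0 (weak_rows w ++ [:: 0]) = head 0 (weak_rows w).
    by case: (weak_rows w).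
  apply/eq_in_map => k; rewrite mem_iota => /andP[k_gt0 _].
  by rewrite count_cat /= leqn0 gtn_eqF ?addn0.
rewrite cats0 (eq_map (addn1 : _ =1 succn)) /rows /= -/(rows _) count_dual.
rewrite -size_weak_rows -IHw; case: (weak_rows w) => [//|x s] /=.
rewrite count_map count_predT (iotaDl 1 1) -map_comp; congr (_ :: _).
by apply: eq_map => k /=; rewrite count_map.
Qed.

(** * Moves on boundary words *)

(* Erasing the letter [b] between [u] and [v] changes the partition. *)
Definition effective (u : word) (b : bool) (v : word) : bool :=
  if b then false \in v else true \in u.

Lemma effective_dual u b v : effective (dual v) (~~ b) (dual u) = effective u b v.
Proof. by case: b; rewrite /effective /= -!has_pred1 !has_count count_dual. Qed.

Lemma dual_deletion u b v : dual (u ++ b :: v) = dual v ++ ~~ b :: dual u.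
Proof. by rewrite dual_cat dual_cons -catA. Qed.

Lemma conjugate_partition_of w : conjugate (partition_of w) = partition_of (dual w).
Proof. by apply: val_inj; rewrite /= conj_rows. Qed.

Lemma row_move_deletion u v : effective u true v ->
  row_move (partition_of (u ++ true :: v)) (partition_of (u ++ v)).
Proof.
rewrite /= -has_pred1 has_count => v_gt0.
rewrite /row_move /= /rows !weak_rows_cat /= !filter_cat /= v_gt0.
(* The rows coming from [u] precede the deleted one and keep their lengths, so their number is its
   index. *)
set s := filter _ (map _ _); exists (size s); first by rewrite size_cat /=; lia.
by rewrite take_size_cat // -cat_rcons drop_size_cat ?size_rcons.
Qed.

Lemma crim_move_deletion u b v : effective u b v ->
  crim_move (partition_of (u ++ b :: v)) (partition_of (u ++ v)).
Proof.
case: b => [|eff_uv]; first by left; exact: row_move_deletion.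
right; exists (partition_of (dual (u ++ v))); last first.
  by rewrite conjugate_partition_of dualK.
rewrite conjugate_partition_of dual_deletion dual_cat.
by apply: row_move_deletion; rewrite (effective_dual u false v).
Qed.

Lemma row_moveE w mu : row_move (partition_of w) mu ->
  exists u v, w = u ++ true :: v /\ mu = partition_of (u ++ v).
Proof.
case=> i /= lt_i mu_del.
suff [u [v [def_w E]]]: exists u v,
    w = u ++ true :: v /\ rows (u ++ v) = take i (rows w) ++ drop i.+1 (rows w).
  by exists u, v; split=> //; apply: val_inj; rewrite /= mu_del E.
elim: w i lt_i {mu mu_del} => [//|[] w IHw] i; last first.
  by case/IHw=> u [v [-> E]]; exists (false :: u), v; split=> //.
have rows_true w' : rows (true :: w') =
    nseq (0 < count_mem false w') (count_mem false w') ++ rows w'.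
  by rewrite /rows /=; case: ltnP.
case: i => [|i] lt_i; last first.
  (* A leading T with no F after it yields no part, so it does not shift the index. *)
  have/IHw: i.+1 - (0 < count_mem false w) < size (rows w).
    by move: lt_i; rewrite rows_true size_cat size_nseq; lia.
  case=> u [v [def_w E]]; exists (true :: u), v; rewrite def_w; split=> //=.
  have: count_mem false (u ++ v) = count_mem false w.
    by rewrite def_w !count_cat /= add0n.
  rewrite -def_w !rows_true E => ->.
  by case: (0 < _) => //=; rewrite ?subn0 ?subn1.
case: (posnP (count_mem false w)) => [w0|w_gt0]; last first.
  by exists [::], w; split=> //; rewrite rows_true w_gt0 /= drop0.
have: 0 < size (rows w) by move: lt_i; rewrite rows_true w0.
case/IHw=> u [v [def_w E]]; exists (true :: u), v; split; rewrite ?def_w //=.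
have: count_mem false (u ++ v) = count_mem false w.
  by rewrite def_w !count_cat /= add0n.
by rewrite -def_w !rows_true w0 E => ->.
Qed.

Lemma crim_moveE w mu : crim_move (partition_of w) mu ->
  exists u b v, w = u ++ b :: v /\ mu = partition_of (u ++ v).
Proof.
case=> [/row_moveE[u [v E]]|[nu]]; first by exists u, true, v.
rewrite conjugate_partition_of => /row_moveE[u [v [def_w ->]]] ->.
exists (dual v), false, (dual u).
rewrite conjugate_partition_of dual_cat; split=> //.
by rewrite -(dual_deletion u true v) -def_w dualK.
Qed.

(** A reply must be a legal move, so its deletion is required to be effective; [crim_moveE] covers
    the opponent's moves by arbitrary deletions. *)
Inductive answer (w : word) : word -> Prop :=
  Answer u b v of effective u b v & w = u ++ b :: v : answer w (u ++ v).

Lemma answerP u b v w w' : effective u b v -> w = u ++ b :: v -> w' = u ++ v ->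
  answer w w'.
Proof. by move=> eff_uv def_w ->; exact: Answer def_w. Qed.

Lemma answer_cat l r w w' : answer w w' -> answer (l ++ w ++ r) (l ++ w' ++ r).
Proof.
case=> u b v eff_uv ->; apply: (@answerP (l ++ u) b (v ++ r)); rewrite -?catA //.
by case: b eff_uv => /= eff_uv; rewrite mem_cat eff_uv ?orbT.
Qed.

Lemma answer_catl l w w' : answer w w' -> answer (l ++ w) (l ++ w').
Proof. by move/(answer_cat l [::]); rewrite !cats0. Qed.

Lemma answer_catr r w w' : answer w w' -> answer (w ++ r) (w' ++ r).
Proof. exact: (@answer_cat [::]). Qed.

Lemma answer_dual w w' : answer w w' -> answer (dual w) (dual w').
Proof.
case=> u b v eff_uv ->; rewrite dual_deletion dual_cat.
by apply: (@answerP (dual v) (~~ b) (dual u)); rewrite ?effective_dual.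
Qed.

Lemma size_answer w w' : answer w w' -> size w' < size w.
Proof. by case=> u b v _ ->; rewrite !size_cat /= addnS. Qed.

Lemma crim_move_answer w w' :
  answer w w' -> crim_move (partition_of w) (partition_of w').
Proof. by case=> u b v eff_uv ->; exact: crim_move_deletion. Qed.

(** * Balanced words *)

Definition block (t : nat * nat * nat) : word :=
  let: (p, k, q) := t in
  nseq p true ++ flatten (nseq k [:: false; true]) ++ nseq q false.

Definition blocks (s : seq (nat * nat * nat)) : word := flatten (map block s).

Definition balanced (t : nat * nat * nat) : bool :=
  let: (p, k, q) := t in
  [&& 0 < p, 0 < q, odd p == odd q
    & (odd k == odd p) || (1 < p) && (1 < q)].

Definition swap (t : nat * nat * nat) := let: (p, k, q) := t in (q, k, p).

Lemma nseq_catSr T n (x : T) s : nseq n x ++ x :: s = nseq n.+1 x ++ s.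
Proof. by elim: n => //= n ->. Qed.

Lemma dual_nseq n b : dual (nseq n b) = nseq n (~~ b).
Proof. by rewrite /dual map_nseq rev_nseq. Qed.

(** The staircase [(FT)^k] is its own dual, so only the two end runs are exchanged. *)
Lemma dual_block t : dual (block t) = block (swap t).
Proof.
case: t => [[p k] q]; rewrite /= !dual_cat !dual_nseq -catA; congr (_ ++ (_ ++ _)).
elim: k => //= k IHk; rewrite -cat1s -[_ :: flatten _]cat1s catA dual_cat IHk.
by elim: k {IHk} => //= k ->.
Qed.

Lemma dual_blocks s : dual (blocks s) = blocks (rev (map swap s)).
Proof.
elim: s => //= t s IHs; rewrite /blocks /= dual_cat IHs dual_block rev_cons.
by rewrite map_rcons flatten_rcons.
Qed.

Lemma swap_balanced s : all balanced (rev (map swap s)) = all balanced s.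
Proof.
rewrite all_rev all_map; apply: eq_all => -[[p k] q] /=; rewrite eq_sym; lia.
Qed.

Lemma blocks_cat s1 s2 : blocks (s1 ++ s2) = blocks s1 ++ blocks s2.
Proof. by rewrite /blocks map_cat flatten_cat. Qed.

(** With no block on the left, the F's vanish from [rows] but not from the word; hence an equality
    of rows, with a size bound for the induction on word length. *)
Lemma absorb_falses s1 j s2 : all balanced s1 -> all balanced s2 ->
  exists2 s, all balanced s &
    rows (blocks s1 ++ nseq j.*2 false ++ blocks s2) = rows (blocks s) /\
    size (blocks s) <= size (blocks s1 ++ nseq j.*2 false ++ blocks s2).
Proof.
case/lastP: s1 => [|s1 [[p k] q]] bal1 bal2.
  exists s2 => //; split; first exact: rows_false.
  by rewrite !size_cat addnA leq_addl.
exists (s1 ++ (p, k, q + j.*2) :: s2).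
  move: bal1; rewrite all_rcons all_cat /= bal2 => /andP[bal_t ->] /=; lia.
suff -> : blocks (s1 ++ (p, k, q + j.*2) :: s2) =
  blocks (rcons s1 (p, k, q)) ++ nseq j.*2 false ++ blocks s2 by [].
rewrite -cats1 -(cat1s (p, k, q + _)) !blocks_cat -!catA; congr (_ ++ _).
by rewrite /blocks /= nseqD -!catA.
Qed.

(** * Answers inside a single block *)

Lemma answer_drop_true p k q : 0 < k + q ->
  answer (block (p.+1, k, q)) (block (p, k, q)).
Proof.
move=> kq; apply: (@answerP [::] true (block (p, k, q))) => //=.
rewrite !mem_cat !mem_nseq; case: k kq => [|k] /=; last by rewrite ?inE ?orbT.
by rewrite add0n => ->; rewrite !orbT.
Qed.

Lemma answer_drop_false p k q : 0 < p + k ->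
  answer (block (p, k, q.+1)) (block (p, k, q)).
Proof.
rewrite addnC => kp.
by have:= answer_dual (answer_drop_true q kp); rewrite !dual_block.
Qed.

(** Erasing the first F of the staircase joins the next T to the leading run, which must be nonempty
    for the deletion to be effective. *)
Lemma answer_drop_inner p k q :
  answer (block (p.+1, k.+1, q)) (block (p.+2, k, q)).
Proof.
apply: (@answerP (nseq p.+1 true) false
          (true :: flatten (nseq k [:: false; true]) ++ nseq q false)) => //.
by rewrite nseq_catSr.
Qed.

Lemma block_falses p k q i : block (p, k, q) ++ nseq i false = block (p, k, q + i).
Proof. by rewrite /= nseqD !catA. Qed.

(** The first F of the second factor joins the tail before it, and the next T becomes a leading
    run. *)
Lemma block_cat0 p k q l m :
  block (p, k, q) ++ block (0, l.+1, m) = block (p, k, q.+1) ++ block (1, l, m).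
Proof. by rewrite -[q.+1]addn1 -block_falses -catA. Qed.

(** The second case erases the T of stair [a + 1], whose F remains as the tail of the left
    factor. *)
Lemma block_deletion p k q u v : block (p, k, q) = u ++ true :: v ->
  0 < p /\ u ++ v = block (p.-1, k, q) \/
  exists a b, k = a + b.+1 /\ u ++ v = block (p, a, 1) ++ block (0, b, q).
Proof.
elim: p u => [|p IHp] u.
  elim: k u => [|k IHk] u /= eq_uv.
    have: true \in nseq q false by rewrite eq_uv mem_cat mem_head orbT.
    by rewrite mem_nseq andbF.
  right; case: u eq_uv => [|c [|d u]] //= [<-].
    by move=> <-; exists 0, k.
  by move=> <- /IHk[[]|[a [b [-> ->]]]] //; exists a.+1, b.
case: u => [|c u] /= [].
  by move=> <-; left.
move=> <- /IHp[[p_gt0 ->]|[a [b [-> ->]]]]; last by right; exists a, b.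
by left; split=> //; case: p p_gt0 {IHp}.
Qed.

(** Splitting on the parity of each variable, with [n = odd n + 2 * n./2], makes the balance
    conditions linear. *)
Ltac parity_lia :=
  rewrite ?oddD /=;
  repeat match goal with
  | |- context [odd ?n] => is_var n; move: (odd_double_half n); case: (odd n)
  end;
  rewrite /= ?andbT ?andbF ?orbT ?orbF //; lia.

Lemma answer_in_block t u v : balanced t -> block t = u ++ true :: v ->
  exists j s, all balanced s /\ answer (u ++ v) (nseq j.*2 false ++ blocks s).
Proof.
case: t => [[p k] q] bal.
have reply1 w t : balanced t -> answer w (block t) ->
    exists j s, all balanced s /\ answer w (nseq j.*2 false ++ blocks s).
  by move=> bal_t ans; exists 0, [:: t]; rewrite /blocks /= bal_t cats0.
have reply2 w t1 t2 : balanced t1 -> balanced t2 ->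
    answer w (block t1 ++ block t2) ->
    exists j s, all balanced s /\ answer w (nseq j.*2 false ++ blocks s).
  move=> bal1 bal2 ans; exists 0, [:: t1; t2].
  by rewrite /blocks /= bal1 bal2 cats0.
have reply_falses w r : ~~ odd r -> answer w (nseq r false) ->
    exists j s, all balanced s /\ answer w (nseq j.*2 false ++ blocks s).
  by move=> r_even ans; exists r./2, [::]; rewrite even_halfK // cats0.
have reply_falses1 w r t : ~~ odd r -> balanced t ->
    answer w (nseq r false ++ block t) ->
    exists j s, all balanced s /\ answer w (nseq j.*2 false ++ blocks s).
  move=> r_even bal_t ans; exists r./2, [:: t].
  by rewrite /blocks /= even_halfK // bal_t cats0.
(* Covers the deletion of a T from the leading run (first alternative) or from the last stair
   (second). The replies tried erase an F of the tail, a T of the leading run, or the first F of the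
   staircase. *)
have reply_block p' k' q' : 0 < p' -> 0 < q' ->
    balanced (p'.+1, k', q') || balanced (p', k'.+1, q'.-1) ->
    exists j s, all balanced s /\
      answer (block (p', k', q')) (nseq j.*2 false ++ blocks s).
  case: p' q' => [|p'] [|q'] // _ _ bal'.
  case: (boolP (balanced (p'.+1, k', q'))) => [bal1|nbal1].
    exact/(reply1 _ _ bal1)/answer_drop_false.
  case: (boolP (balanced (p', k', q'.+1))) => [bal2|nbal2].
    by apply: (reply1 _ _ bal2); apply: answer_drop_true; rewrite addnS.
  case: k' => [|k'] in bal' nbal1 nbal2 *.
    have p'0 : p' = 0 by move: bal' nbal1 nbal2 => /=; parity_lia.
    rewrite p'0 in bal' nbal1 nbal2 *.
    apply: (reply_falses _ q'.+1); first by move: bal' nbal1 nbal2 => /=; parity_lia.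
    exact: (@answer_drop_true 0 0).
  apply: (reply1 _ (p'.+2, k', q'.+1)); last exact: answer_drop_inner.
  move: bal' nbal1 nbal2 => /=.
  by parity_lia.
case/block_deletion=> [[p_gt0 ->]|[a [b [def_k ->]]]].
  case: p p_gt0 bal => // -[|p] _ bal.
    (* The run was a single T, so balance makes [k] and [q] odd; erasing the next T leaves
       [F^(q+1)], or [F^2] before a balanced block. *)
    case: k bal => [|[|k]] /= bal.
    - lia.
    - apply: (reply_falses _ q.+1); first lia.
      apply: (@answer_catl [:: false] (block (1, 0, q)) (block (0, 0, q))).
      by apply: answer_drop_true; lia.
    - apply: (reply_falses1 _ 2 (1, k, q)) => //=; first lia.
      by apply: (@answer_catl [:: false]); exact: (@answer_drop_true 0 k.+1).
  by apply: reply_block; rewrite ?bal //; case/and3P: bal.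
case: b def_k => [|b] def_k.
  rewrite block_falses add1n; apply: reply_block => //; last first.
    by rewrite -[a.+1]addn1 -def_k bal orbT.
  by case/and3P: bal.
rewrite block_cat0.
have b1q : 0 < b + q by move: bal => /=; lia.
(* Here the left block is [TFF]; erasing its T leaves [F^2], and [b = k - 2] has the parity of
   [k]. *)
case: (boolP ((p == 1) && (a == 0))) => [/andP[/eqP p1 /eqP a0]|].
  rewrite p1 a0 in def_k bal *.
  apply: (reply_falses1 _ 2 (1, b, q)) => //; first by move: bal => /=; lia.
  by apply: answer_catr; exact: (@answer_drop_true 0 0 2).
case: b => [|b] in def_k b1q * => nlast.
  (* The two blocks merge into one; [a = k - 2] and [q + 2] keep the parities. *)
  apply: (reply1 _ (p, a, 2 + q)); first by move: bal nlast; rewrite def_k /=; parity_lia.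
  by rewrite -block_falses; apply: answer_catl; exact: (@answer_drop_true 0 0).
(* Now [k = a + b + 3]. For even [p] and [q] this reply always works, all end runs being even and at
   least 2. *)
case: (boolP (balanced (p, a, 2) && balanced (2, b, q))) => [/andP[bal1 bal2]|n1].
  apply: (reply2 _ _ _ bal1 bal2); apply: answer_catl.
  exact: answer_drop_inner.
(* From here on [p] and [q] are odd. This reply works for odd [b]: if [p = 1], then [k] is odd,
   hence so is [a]. *)
case: (boolP (balanced (p, a, 3) && balanced (1, b, q))) => [/andP[bal1 bal2]|n2].
  apply: (reply2 _ _ _ bal1 bal2); rewrite -(block_cat0 p a 2).
  by apply: answer_catl; exact: answer_drop_true.
(* This reply settles even [b] with odd [a]. *)
case: (boolP (balanced (p, a, 1) && balanced (1, b.+1, q))) => [/andP[bal1 bal2]|n3].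
  apply: (reply2 _ _ _ bal1 bal2); apply: answer_catr; apply: answer_drop_false.
  by case/and3P: bal => p_gt0 _ _; rewrite addn_gt0 p_gt0.
case: p => [|p] in def_k bal nlast n1 n2 n3 *; first by [].
(* Now [a] and [b] are even, and [p] is one less than the original run; dropping a leading T works
   if that run had at least 3 letters. *)
case: (boolP (balanced (p, a, 2) && balanced (1, b.+1, q))) => [/andP[bal1 bal2]|n4].
  apply: (reply2 _ _ _ bal1 bal2); apply: answer_catr; apply: answer_drop_true.
  by rewrite addn2.
case: a => [|a] in def_k bal nlast n1 n2 n3 n4 *.
  by move: bal nlast n1 n2 n3 n4; rewrite def_k /=; parity_lia.
(* Only [p = 0] is left; the left block becomes [(2, a, 2)], balanced for every [a]. *)
apply: (reply2 _ (p.+2, a, 2) (1, b.+1, q)); last first.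
- by apply: answer_catr; exact: answer_drop_inner.
- by move: bal nlast n1 n2 n3 n4; rewrite def_k /=; parity_lia.
- by move: bal nlast n1 n2 n3 n4; rewrite def_k /=; parity_lia.
Qed.

(** * Deletions in a sequence of balanced blocks *)

Lemma cat_eq_cat_cons (T : Type) (x y u v : seq T) (b : T) :
  x ++ y = u ++ b :: v ->
  (exists2 v', x = u ++ b :: v' & v = v' ++ y) \/
  (exists2 u', y = u' ++ b :: v & u = x ++ u').
Proof.
elim: x u => [|c x IHx] u /=; first by move=> ->; right; exists u.
case: u => [|d u] /= [-> eq_xy]; first by left; exists x.
by case/IHx: eq_xy => [[v' -> ->]|[u' -> ->]]; [left; exists v'|right; exists u'].
Qed.

Lemma blocks_deletion s u b v : blocks s = u ++ b :: v ->
  exists s1 t s2 u' v', [/\ s = s1 ++ t :: s2, block t = u' ++ b :: v',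
    u = blocks s1 ++ u' & v = v' ++ blocks s2].
Proof.
elim: s u => [|t s IHs] u; first by case: u.
case/(@cat_eq_cat_cons _ (block t) (blocks s))=> [[v' def_t ->]|[u' /IHs]].
  by exists [::], t, s, u, v'.
case=> s1 [t1 [s2 [u1 [v1 [-> def_t1 -> ->]]]]] ->.
by exists (t :: s1), t1, s2, u1, v1; rewrite /blocks /= catA.
Qed.

(** The reply is made in the block hit by the deletion. The word [w] may keep leading F's, so it is
    compared with [blocks s'] through [rows] and size only. *)
Lemma answer_true_deletion s u v : all balanced s -> blocks s = u ++ true :: v ->
  exists w s', [/\ all balanced s', answer (u ++ v) w,
    rows w = rows (blocks s') & size (blocks s') <= size w].
Proof.
move=> bal_s /blocks_deletion[s1 [t [s2 [u' [v' [def_s def_t -> ->]]]]]].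
move: bal_s; rewrite def_s all_cat /= => /and3P[bal1 bal_t bal2].
have [j [s3 [bal3 ans]]] := answer_in_block bal_t def_t.
have bal32: all balanced (s3 ++ s2) by rewrite all_cat bal3.
have [s' bal' [eq_rows le_size]] := absorb_falses j bal1 bal32.
exists (blocks s1 ++ nseq j.*2 false ++ blocks (s3 ++ s2)), s'; split=> //.
have:= answer_cat (blocks s1) (blocks s2) ans.
by rewrite blocks_cat -!catA.
Qed.

Lemma answer_deletion s u b v : all balanced s -> blocks s = u ++ b :: v ->
  exists w s', [/\ all balanced s', answer (u ++ v) w,
    rows w = rows (blocks s') & size (blocks s') <= size w].
Proof.
case: b => [|bal_s def_s]; first exact: answer_true_deletion.
have dual_s : blocks (rev (map swap s)) = dual v ++ true :: dual u.
  by rewrite -dual_blocks def_s dual_deletion.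
rewrite -swap_balanced in bal_s.
have [w [s' [bal' ans eq_rows le_size]]] := answer_true_deletion bal_s dual_s.
exists (dual w), (rev (map swap s')); split.
- by rewrite swap_balanced.
- by have:= answer_dual ans; rewrite -dual_cat dualK.
(* [rows (dual w)] is the conjugate of [rows w], so an equality of rows survives dualization. *)
- by rewrite -dual_blocks -!conj_rows eq_rows.
- by rewrite -dual_blocks !size_dual.
Qed.

Lemma P_position_blocks s : all balanced s -> P_position (partition_of (blocks s)).
Proof.
(* Word length is the measure: a deletion and its reply shorten the word, and passing to [s'] does
   not lengthen it. *)
have [n] := ubnP (size (blocks s)); elim: n s => // n IHn s lt_s bal_s.
constructor=> _ /crim_moveE[u [b [v [def_s ->]]]].
have [w [s' [bal' ans eq_rows le_size]]] := answer_deletion bal_s def_s.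
apply: N_intro (crim_move_answer ans) _.
have -> : partition_of w = partition_of (blocks s') by exact: val_inj.
apply: IHn bal'; apply: leq_ltn_trans le_size _.
apply: leq_trans (size_answer ans) _.
by move: lt_s; rewrite def_s !size_cat /= addnS; lia.
Qed.

(** * Melds of rectairs *)

(** The rows are unfiltered so that concatenation applies directly; the count of F's is the amount
    by which a meld shifts the other partition. *)
Definition encodes (s : seq (nat * nat * nat)) (la : intpart) : Prop :=
  [/\ all balanced s, la = weak_rows (blocks s) :> seq nat
    & head 0 la = count_mem false (blocks s)].

(** The rows of [mu], lengthened by the first part of [la], come on top, so their word comes
    first. *)
Lemma encodes_meld s t la mu :
  encodes s la -> encodes t mu -> encodes (t ++ s) (meld la mu).
Proof.
case=> bal_s def_la head_la [bal_t def_mu head_mu]; split.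
- by rewrite all_cat bal_s bal_t.
- rewrite blocks_cat weak_rows_cat -def_la -def_mu -head_la /= /meld_parts.
  by congr (_ ++ _); apply: eq_map => x; rewrite addnC.
- by rewrite head_meld_parts head_la head_mu blocks_cat count_cat addnC.
Qed.

Lemma partition_of_encodes s la : encodes s la -> la = partition_of (blocks s).
Proof.
case=> _ def_la _; apply: val_inj; rewrite /= /rows -def_la.
by have /andP[_ /all_filterP->] := intpartP la.
Qed.

Lemma count_stairs k q :
  count_mem false (flatten (nseq k [:: false; true]) ++ nseq q false) = q + k.
Proof. by elim: k => [|k /= ->]; rewrite ?count_nseq /=; lia. Qed.

Lemma weak_rows_stairs k q :
  weak_rows (flatten (nseq k [:: false; true]) ++ nseq q false) =
  [seq q + k - i | i <- iota 1 k].
Proof.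
elim: k => [|k IHk] /=; first by elim: q.
by rewrite count_stairs IHk addnS subn1 (iotaDl 1 1) -map_comp.
Qed.

Lemma weak_rows_block p k q :
  weak_rows (block (p, k, q)) = rectair_parts k (p + k) (q + k).
Proof.
rewrite /rectair_parts addnK -weak_rows_stairs.
by elim: p => //= p ->; rewrite count_cat count_nseq count_stairs.
Qed.

Lemma balanced_rectair_encodes la :
  is_balanced_rectair la -> exists s, encodes s la.
Proof.
case=> [->|[k [r [c [[_ _ lt_k def_la] even_rank r_ge2 c_ge2 odd_bound]]]]].
  by exists [::].
have rowsE : la = weak_rows (block (r - k, k, c - k)) :> seq nat.
  by rewrite weak_rows_block def_la !subnK //; lia.
have head_la : head 0 la = c.
  by rewrite def_la /rectair_parts; case def_rk: (r - k) => //=; lia.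
exists [:: (r - k, k, c - k)]; rewrite /encodes /blocks [flatten _]cats0.
split=> //; last first.
  by rewrite head_la count_cat count_nseq count_stairs /=; lia.
have: size la = r.
  by rewrite def_la size_cat size_nseq size_map size_iota; lia.
move: even_rank; rewrite /rank head_la => + size_la; rewrite size_la /=.
(* If [k] and [r - k] differ in parity, then [r] and [c] are odd, and the bound on [k] makes [r - k]
   and [c - k] at least 2. *)
lia.
Qed.

Theorem theorem3 (m : nat) (mu : 'I_m -> intpart)
  (balanced_mu : forall i : 'I_m, is_balanced_rectair (mu i)) :
  P_position (\big[meld/empty_partition]_(i < m) mu i).
Proof.
suff [s enc_s]: exists s, encodes s (\big[meld/empty_partition]_(i < m) mu i).
  rewrite (partition_of_encodes enc_s); apply: P_position_blocks.
  by case: enc_s.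
apply: (big_ind (fun la => exists s, encodes s la))
  => [|la nu [s enc_s] [t enc_t]|i _].
- by exists [::].
- by exists (t ++ s); exact: encodes_meld.
- exact: balanced_rectair_encodes.
Qed.
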